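(* Let $A_k\in\mathbb{C}^{n\times n}$ be a matrix all of whose eigenvalues have positive real parts. Let $$\nu_n=\max_j\sigma_j(A_k),\qquad a_\mu=\min_j\mathrm{Re}(\lambda_j(A_k)),$$ where $\sigma_j(A_k)$ and $\lambda_j(A_k)$ are the singular values and the eigenvalues of $A_k$. Then the quasi-optimal parameter $\alpha_k^*$ is given by $$\alpha_k^*=\arg\min_{\alpha_k>0}\frac{\nu_n^2-2\alpha_k a_\mu+\alpha_k^2}{\nu_n^2+2\alpha_k a_\mu+\alpha_k^2}=\nu_n.$$
   Context: In the paper $A_k=KX_k-A$, where $A,K\in\mathbb{C}^{n\times n}$ are coefficients of the Riccati equation $A^*X+XA-XKX+Q=0$ ($K=K^*$, $Q=Q^*$) and $X_k$ is the $k$-th Newton iterate; $\alpha_k>0$ is the parameter of the (generalized) alternating-direction implicit iteration for the Lyapunov equation $A_k^*X+XA_k=X_kKX_k+Q$. The ''quasi-optimal parameter'' $\alpha_k^*$ means the minimizer over $\alpha_k>0$ of the displayed function, which the paper uses as an upper bound for the spectral radius of the iteration matrix $T_k(\alpha_k)=(\alpha_k I+A_k^T\otimes I)^{-1}(\alpha_k I+I\otimes A_k^* )^{-1}(\alpha_k I-I\otimes A_k^* )(\alpha_k I-A_k^T\otimes I)$, where $\otimes$ is the Kronecker product. *)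

(* Defs.v *)
From mathcomp Require Import all_boot all_order all_algebra.
From mathcomp Require Import complex.
From mathcomp Require Import boolp classical_sets reals.

Set Implicit Arguments.
Unset Strict Implicit.
Unset Printing Implicit Defensive.

Import Order.TTheory GRing.Theory Num.Theory.

Local Open Scope classical_set_scope.
Local Open Scope ring_scope.
Local Open Scope sesquilinear_scope.

Section Defs.
Variable R : realType.

(* The eigenvalues are listed with algebraic multiplicity, in an unspecified
   order. *)
Definition eigenvalues n (A : 'M[R[i]]_n) : seq R[i] :=
  sval (closed_field_poly_normal (char_poly A)).

Lemma char_poly_eigenvalues n (A : 'M[R[i]]_n) :
  char_poly A = \prod_(z <- eigenvalues A) ('X - z%:P).
Proof.
rewrite /eigenvalues; case: closed_field_poly_normal => r /= ->.
by rewrite (monicP (char_poly_monic A)) scale1r.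
Qed.

Lemma size_eigenvalues n (A : 'M[R[i]]_n) : size (eigenvalues A) = n.
Proof.
apply/eqP; rewrite -eqSS -(size_prod_XsubC _ id).
by rewrite -char_poly_eigenvalues size_char_poly.
Qed.

Lemma mem_eigenvalues n (A : 'M[R[i]]_n) (z : R[i]) :
  (z \in eigenvalues A) = eigenvalue A z.
Proof.
by rewrite eigenvalue_root_char char_poly_eigenvalues root_prod_XsubC.
Qed.

Definition lambda n (A : 'M[R[i]]_n) (j : 'I_n) : R[i] := (eigenvalues A)`_j.

(* The eigenvalues of A^* A are real and nonnegative, so taking their real part
   before the real square root loses nothing. *)
Definition sigma n (A : 'M[R[i]]_n) (j : 'I_n) : R :=
  Num.sqrt (complex.Re (lambda (A^t* *m A) j)).

(* In both definitions the initial value of the iterated operation is one of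
   the terms, so these are the true maximum and minimum over j. *)
Definition max_sigma n (A : 'M[R[i]]_n.+1) : R :=
  \big[Num.max/sigma A ord0]_(j < n.+1) sigma A j.

Definition min_Re_lambda n (A : 'M[R[i]]_n.+1) : R :=
  \big[Num.min/complex.Re (lambda A ord0)]_(j < n.+1) complex.Re (lambda A j).

(* The set of all minimizers of f on D; "argmin f = x" means that this set is
   the singleton of x. *)
Definition argmin (D : set R) (f : R -> R) : set R :=
  [set x | D x /\ forall y, D y -> f x <= f y].

End Defs.

(* Main.v *)
Require Import Defs.
From mathcomp Require Import all_boot all_order all_algebra.
From mathcomp Require Import complex.
From mathcomp Require Import boolp classical_sets reals.
From mathcomp Require Import ring.

Set Implicit Arguments.
Unset Strict Implicit.
Unset Printing Implicit Defensive.

Import Order.TTheory GRing.Theory Num.Theory.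
Local Open Scope classical_set_scope.
Local Open Scope ring_scope.
Local Open Scope sesquilinear_scope.

(** Write [D x = nu ^+ 2 + 2 * x * a + x ^+ 2]; the function to be minimized
    is [f x = 1 - 4 * a * x / D x].  Bringing the difference of two values to
    a common denominator shows that
    [f x - f nu = 4 * a * nu * (x - nu) ^+ 2 / (D x * D nu)],
    so as soon as [a] and [nu] are positive, [nu] is the only minimizer on the
    positive half-line ([argmin_adi_ratio]).

    Both positivity facts come from the hypothesis on the spectrum.  For
    [a = min_Re_lambda A] it is immediate.  For [nu = max_sigma A], the value
    0 is not an eigenvalue of [A], hence [A] is invertible and [A^t* *m A] is
    positive definite: all its eigenvalues are positive
    ([eigenvalue_gram_gt0]), so all singular values are. *)

Lemma eigenvalue_lambda (R : realType) n (A : 'M[R[i]]_n) (j : 'I_n) :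
  eigenvalue A (lambda A j).
Proof. by rewrite -mem_eigenvalues mem_nth // size_eigenvalues. Qed.

Lemma unitmx_eigenvalue0 (F : fieldType) n (A : 'M[F]_n) :
  ~~ eigenvalue A 0 -> A \in unitmx.
Proof.
apply: contraR; rewrite -row_free_unit -kermx_eq0.
by rewrite /eigenvalue /eigenspace raddf0 subr0.
Qed.

(** If [v *m (B^t* *m B) = z *: v], pairing with [v] gives
    [`|w| ^+ 2 = z * `|v| ^+ 2] for [w = v *m B^t*], and [w] is nonzero
    because [B] is invertible. *)
Lemma eigenvalue_gram_gt0 (C : numClosedFieldType) n (B : 'M[C]_n) (z : C) :
  B \in unitmx -> eigenvalue (B^t* *m B) z -> 0 < z.
Proof.
move=> Bu /eigenvalueP[v vBB v0].
have w0 : v *m B^t* != 0.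
  apply: contra_neq v0 => w0.
  by rewrite -[v](mulmxK (_ : B^t* \in unitmx)) ?w0 ?mul0mx // map_unitmx
    unitmx_tr.
have: 0 < dotmx (v *m B^t*) (v *m B^t*) by rewrite dnorm_gt0.
have -> : dotmx (v *m B^t*) (v *m B^t*) = z * dotmx v v.
  rewrite !dotmxE trmx_mul map_mxM trmxCK mulmxA -(mulmxA v) vBB -scalemxAl.
  by rewrite mxE.
by rewrite pmulr_lgt0 // dnorm_gt0.
Qed.

Lemma min_Re_lambda_gt0 (R : realType) n (A : 'M[R[i]]_n.+1) :
  (forall z, eigenvalue A z -> 0 < complex.Re z) -> 0 < min_Re_lambda A.
Proof.
by move=> hA; apply: lt_bigmin => [|j _]; apply/hA/eigenvalue_lambda.
Qed.

Lemma max_sigma_gt0 (R : realType) n (A : 'M[R[i]]_n.+1) :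
  A \in unitmx -> 0 < max_sigma A.
Proof.
move=> Au; apply: (@lt_le_trans _ _ (sigma A ord0)); last exact: bigmax_ge_id.
have := eigenvalue_gram_gt0 Au (eigenvalue_lambda (A^t* *m A) ord0).
by rewrite ltcE => /andP[_]; rewrite sqrtr_gt0.
Qed.

Lemma argmin_adi_ratio (R : realType) (nu a : R) : 0 < nu -> 0 < a ->
  argmin [set x : R | 0 < x]
    (fun x : R => (nu ^+ 2 - 2 * x * a + x ^+ 2) /
                  (nu ^+ 2 + 2 * x * a + x ^+ 2))
  = [set nu].
Proof.
move=> nu0 a0; pose D x : R := nu ^+ 2 + 2 * x * a + x ^+ 2.
pose f x := (nu ^+ 2 - 2 * x * a + x ^+ 2) / D x.
have D_gt0 x : 0 < x -> 0 < D x.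
  by move=> x0; rewrite !addr_gt0 ?mulr_gt0 ?exprn_gt0.
have fB x : 0 < x -> f x - f nu = 4 * a * nu * (x - nu) ^+ 2 / (D x * D nu).
  move=> x0; have := lt0r_neq0 (D_gt0 x x0); have := lt0r_neq0 (D_gt0 nu nu0).
  by rewrite /f /D => Dnu Dx; field; rewrite Dnu Dx.
have c_gt0 : 0 < 4 * a * nu by rewrite !mulr_gt0.
have DD_gt0 x : 0 < x -> 0 < D x * D nu by move=> x0; rewrite mulr_gt0 ?D_gt0.
apply/seteqP; split=> [x [/= x0 /(_ nu nu0)]|_ ->].
- rewrite -/(D x) -/(D nu) -/(f x) -/(f nu) -subr_le0 fB //.
  by rewrite pmulr_lle0 ?invr_gt0 ?DD_gt0 // pmulr_rle0 // real_exprn_even_le0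
    ?num_real //= subr_eq0 => /eqP.
- split=> // x /= x0; rewrite -/(D x) -/(D nu) -/(f x) -/(f nu) -subr_ge0 fB //.
  by rewrite divr_ge0 ?(ltW (DD_gt0 _ _)) // mulr_ge0 ?sqr_ge0 // ltW.
Qed.

Theorem theorem2p9 (R : realType) (n : nat) (A : 'M[R[i]]_n.+1)
    (hA : forall z : R[i], eigenvalue A z -> 0 < complex.Re z) :
  let nu := max_sigma A in
  let a := min_Re_lambda A in
  argmin [set alpha : R | 0 < alpha]
    (fun alpha : R =>
       (nu ^+ 2 - 2 * alpha * a + alpha ^+ 2) /
       (nu ^+ 2 + 2 * alpha * a + alpha ^+ 2))
  = [set nu].
Proof.
apply: argmin_adi_ratio; last exact: min_Re_lambda_gt0.
apply/max_sigma_gt0/unitmx_eigenvalue0/negP => /hA.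
by rewrite ltxx.
Qed.
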